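(* For every integer $k \ge 65$ with $k \not\equiv 2 \pmod{20}$ and $k \not\equiv 11 \pmod{20}$, we have $f(6,k) = \left\lceil \frac{49k}{20} \right\rceil$.
   Context: Let $Q^n = \{0,1\}^n$. For $k \in \mathbb{N}$, an almost $k$-cover of $Q^n$ is a multiset of affine hyperplanes in $\mathbb{R}^n$, none of which contains the origin, such that every nonzero point of $Q^n$ lies in at least $k$ of the hyperplanes (counted with multiplicity). $f(n,k)$ denotes the minimum size of an almost $k$-cover of $Q^n$. *)

(* Defs.v *)
From HB Require Import structures.
From mathcomp Require Import all_boot all_order all_algebra.
From mathcomp Require Import finmap multiset.
From mathcomp Require Import boolp classical_sets reals.

Set Implicit Arguments.
Unset Strict Implicit.
Unset Printing Implicit Defensive.

Import Order.TTheory GRing.Theory Num.Theory.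

Local Open Scope mset_scope.
Local Open Scope classical_set_scope.
Local Open Scope ring_scope.

Section AlmostCover.
Variables (R : realType) (n : nat).

Definition cube : set 'rV[R]_n :=
  [set x | forall i, x 0 i = 0 \/ x 0 i = 1].

Definition affine_hyperplane (H : set 'rV[R]_n) : Prop :=
  exists (a : 'rV[R]_n) (b : R),
    a != 0 /\ H = [set x | \sum_i a 0 i * x 0 i = b].

(* A multiset coerces to a sequence in which each element is repeated
   according to its multiplicity, so count and size take multiplicities into
   account. *)
Definition almost_cover (k : nat) (A : {mset set 'rV[R]_n}) : Prop :=
  (forall H, H \in A -> affine_hyperplane H /\ ~ H 0) /\
  (forall x, cube x -> x != 0 -> (k <= count (fun H => x \in H) A)%N).

Definition has_almost_cover (k m : nat) : Prop :=
  exists A : {mset set 'rV[R]_n}, almost_cover k A /\ size A = m.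

(* The hyperplanes x_i = 1, each taken k times, form an almost k-cover, so the
   minimum below is over a nonempty set. *)
Lemma has_almost_cover_ex (k : nat) :
  exists m, `[< has_almost_cover k m >].
Proof.
pose h (i : 'I_n) : set 'rV[R]_n := [set x | x 0 i = 1].
pose s := flatten [seq nseq k (h i) | i <- enum 'I_n].
have ps : perm_eq (seq_mset s) s by exact: perm_eq_seq_mset.
exists (size (seq_mset s)); apply/asboolP; exists (seq_mset s); split=> //.
split=> [H|x x01 xn0].
  rewrite -[H \in seq_mset s]/(H \in (seq_mset s : seq _)) (perm_mem ps).
  move=> /flattenP[t /mapP[i _ ->]] /nseqP[-> _]; split; last first.
    by rewrite /h /= mxE => /esym/eqP; rewrite oner_eq0.
  exists (delta_mx 0 i), 1; split.
    apply/eqP => /matrixP/(_ 0 i)/eqP.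
    by rewrite !mxE !eqxx /= oner_eq0.
  have E (x : 'rV[R]_n) : \sum_j (delta_mx 0 i : 'rV[R]_n) 0 j * x 0 j = x 0 i.
    rewrite (bigD1 i) //= big1 ?addr0 ?mxE ?eqxx ?mul1r // => j ji.
    by rewrite mxE (negbTE ji) mul0r.
  by apply/seteqP; split => x /=; rewrite E.
have /existsP[i xi] : [exists i, x 0 i != 0].
  apply: contraNT xn0 => /existsPn x0; apply/eqP/rowP => j.
  by rewrite mxE; apply/eqP; have := x0 j; rewrite negbK.
rewrite (permP ps) /s count_flatten -map_comp sumnE big_map big_enum /=.
rewrite (bigD1 i) //= count_nseq.
have -> : x \in h i.
  by rewrite inE /h /=; case: (x01 i) xi => -> //; rewrite eqxx.
by rewrite mul1n leq_addr.
Qed.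

Definition f (k : nat) : nat := ex_minn (has_almost_cover_ex k).

End AlmostCover.

(* Main.v *)
(* Lower bound: give a nonempty set S of coordinates, seen as a point of the
   cube, the weight (|S| - 1)! (n - |S|)!. Write a hyperplane avoiding 0 as
   a . x = 1 and order the n coordinates in all possible ways. By the cycle lemma
   at least one of the |S| rotations of every ordering of a set S with a(S) = 1 has
   all its proper prefix sums below 1, and each ordering of the coordinates is
   counted for at most one S in this way, so the points of a hyperplane weigh at
   most n! together. All points together weigh n! (1 + 1/2 + ... + 1/n), which is
   1764 = 720 * 49 / 20 for n = 6.

   Upper bound: there is an almost 20-cover of size exactly 49, so it suffices
   to have explicit covers for 65 <= k < 85. They were found by a computer search
   among the hyperplanes a . x = 1 with integer entries a_i <= 1 and
   a_1 + ... + a_6 >= 1, all of which attain the maximal weight n!. *)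
Require Import Defs.
From HB Require Import structures.
From mathcomp Require Import all_boot all_order all_algebra all_fingroup.
From mathcomp Require Import finmap multiset.
From mathcomp Require Import boolp classical_sets reals.
From mathcomp Require Import zify lra.

Set Implicit Arguments.
Unset Strict Implicit.
Unset Printing Implicit Defensive.

Import Order.TTheory GRing.Theory Num.Theory.

Local Open Scope ring_scope.

(** * Orderings of the coordinates and the weight of a single hyperplane *)

(* Cycle lemma: rotate to start just after the first place where the prefix
   sum is maximal. *)
Lemma rotation_prefix_sum (R : realDomainType) (w : nat) (s : nat -> R) :
  0 < \sum_(i < w) s i ->
  exists r : 'I_w, forall j, (j < w)%N ->
    \sum_(i < j) s ((i + r) %% w)%N < \sum_(i < w) s i.
Proof.
case: w => [|w] s_gt0; first by rewrite big_ord0 ltxx in s_gt0.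
(* Prefix sums of the periodic extension of [s]; the sum over any rotated window is a difference of
   two values of [Q]. *)
pose Q m := \sum_(0 <= i < m) s (i %% w.+1)%N.
have Qw : \sum_(i < w.+1) s i = Q w.+1.
  by rewrite /Q big_mkord; apply: eq_bigr => i _; rewrite modn_small.
have QwD m : Q (w.+1 + m)%N = Q w.+1 + Q m.
  rewrite /Q (@big_cat_nat _ _ _ w.+1) ?leq_addr //=; congr (_ + _).
  rewrite -{1}[w.+1]add0n big_addn addKn.
  by apply: eq_bigr => i _; rewrite modnDr.
have [r0 r0max] : exists r0 : 'I_w.+1, forall i : 'I_w.+1, Q i <= Q r0.
  by exists [arg max_(i > ord0) Q i]%O; case: arg_maxP => // i _ Hi j; apply: Hi.
(* The least index reaching the maximum: minimality supplies strictness once the window wraps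
   around. *)
have [|r /andP[rw Qr] rmin] := @ex_minnP (fun r => (r < w.+1)%N && (Q r0 <= Q r)).
  by exists r0; rewrite ltn_ord lexx.
exists (Ordinal rw) => j jw /=.
have -> : \sum_(i < j) s ((i + r) %% w.+1)%N = Q (r + j)%N - Q r.
  rewrite /Q (@big_cat_nat _ _ _ r) ?leq_addr //= addrAC subrr add0r.
  by rewrite -{2}[r]add0n big_addn addKn big_mkord.
have [rj|rj] := ltnP (r + j) w.+1.
  rewrite ltrBlDr (le_lt_trans (r0max (Ordinal rj))) //.
  by rewrite (le_lt_trans Qr) // ltrDr.
(* After a wrap one full period cancels. What remains is a prefix of length below [r], whose sum is
   less than [Q r] by minimality. *)
rewrite -(subnKC rj) QwD Qw ltrBlDr ltrD2l.
have lt_r : (r + j - w.+1 < r)%N by lia.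
apply: lt_le_trans Qr; rewrite ltNge; apply/negP => Qge.
by have := rmin (r + j - w.+1)%N; rewrite Qge (ltn_trans lt_r rw) => /(_ isT); lia.
Qed.

Section Prefixes.
Variables (R : realFieldType) (n : nat) (a : 'I_n -> R).
Implicit Types (p : {perm 'I_n}) (S : {set 'I_n}).

Lemma card_set_ord S : (#|S| <= n)%N.
Proof. by rewrite -[X in (_ <= X)%N]card_ord max_card. Qed.

Definition prefix p w : {set 'I_n} := [set p i | i : 'I_n & (i < w)%N].

Definition prefix_sum p j : R := \sum_(i : 'I_n | (i < j)%N) a (p i).

(** For [S] of sum 1: the running sums along [p] reach 1 for the first time exactly when [S] is
    exhausted. *)
Definition first_hit S p : bool :=
  (prefix p #|S| == S) &&
  [forall j : 'I_n, (j < #|S|)%N ==> (prefix_sum p j < 1)].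

(** The default value of [insubd] is never taken when [w <= n]. *)
Definition rotate_prefix_fun (w r : nat) (i : 'I_n) : 'I_n :=
  insubd i (if (i < w)%N then (i + r) %% w else i)%N.

Lemma val_rotate_prefix_fun w r i : (w <= n)%N ->
  val (rotate_prefix_fun w r i) = (if (i < w)%N then (i + r) %% w else i)%N.
Proof.
move=> wn; rewrite /rotate_prefix_fun val_insubd; case: (ltnP i w) => iw.
  by rewrite (leq_trans _ wn) // ltn_mod; lia.
by rewrite ltn_ord.
Qed.

Lemma rotate_prefix_inj w r : (w <= n)%N -> injective (rotate_prefix_fun w r).
Proof.
move=> wn i j /(congr1 val); rewrite !val_rotate_prefix_fun // => eq_ij.
have mod_lt m : (0 < w -> m %% w < w)%N by move=> w0; rewrite ltn_mod.
apply: val_inj; move: eq_ij; case: ifP => iw; case: ifP => jw; last by [].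
- by move=> /eqP; rewrite eqn_modDr !modn_small // => /eqP.
- by move=> eq_ij; have := mod_lt (i + r)%N; lia.
- by move=> eq_ij; have := mod_lt (j + r)%N; lia.
Qed.

Definition rotate_prefix w r (wn : (w <= n)%N) : {perm 'I_n} :=
  perm (rotate_prefix_inj (r := r) wn).

Lemma prefix_rotate w r (wn : (w <= n)%N) p :
  prefix (rotate_prefix r wn * p) w = prefix p w.
Proof.
have -> : prefix (rotate_prefix r wn * p) w =
    p @: (rotate_prefix r wn @: [set i : 'I_n | (i < w)%N]).
  by rewrite -imset_comp; apply: eq_imset => i; rewrite permM.
rewrite /prefix; set P := [set i : 'I_n | _]; congr (p @: (_ : {set _})).
apply/eqP; rewrite eqEcard card_imset ?leqnn ?andbT; last exact: perm_inj.
apply/fintype.subsetP => _ /imsetP[i + ->].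
rewrite !inE permE val_rotate_prefix_fun // => iw.
by rewrite iw ltn_mod; lia.
Qed.

Lemma prefix_sum_full p S :
  prefix p #|S| = S -> prefix_sum p #|S| = \sum_(x in S) a x.
Proof.
move=> {2}<-; rewrite big_imset /=; last by move=> i j _ _; apply: perm_inj.
by apply: eq_bigl => i; rewrite inE.
Qed.

(** The cycle lemma applied to the values of [a] along the first [#|S|] positions of [p]; rotating
    these positions keeps the prefix set equal to [S]. *)
Lemma some_rotation_first_hit S (wn : (#|S| <= n)%N) p :
  \sum_(x in S) a x = 1 -> prefix p #|S| = S ->
  exists r : 'I_#|S|, first_hit S (rotate_prefix r wn * p).
Proof.
(* Extension by 0 to all naturals, the form required by the cycle lemma. *)
move=> S1 pS; pose s m := if insub m is Some i then a (p i) else 0.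
have sE (i : 'I_n) : s i = a (p i) by rewrite /s valK.
have s1 : \sum_(i < #|S|) s i = 1.
  rewrite (big_ord_widen _ s wn) -S1 -(prefix_sum_full pS).
  by apply: eq_bigr => i _; rewrite sE.
have [|r Hr] := @rotation_prefix_sum _ #|S| s; first by rewrite s1.
exists r; rewrite /first_hit prefix_rotate pS eqxx /=.
apply/forallP => j; apply/implyP => jS; rewrite -s1; apply: le_lt_trans (Hr j jS).
rewrite (big_ord_widen _ (fun i => s ((i + r) %% #|S|)%N) (ltnW (ltn_ord j))).
rewrite le_eqVlt; apply/orP; left; apply/eqP; apply: eq_bigr => i ij.
by rewrite permM -sE permE val_rotate_prefix_fun // (ltn_trans ij jS).
Qed.

(** If one set were smaller, its sum 1 would be a proper prefix sum of the other, which must stay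
    below 1. So the lengths agree, and both sets are the same prefix of [p]. *)
Lemma first_hit_uniq S1 S2 p :
  \sum_(x in S1) a x = 1 -> \sum_(x in S2) a x = 1 ->
  first_hit S1 p -> first_hit S2 p -> S1 = S2.
Proof.
move=> S11 S21 /andP[/eqP p1 /forallP h1] /andP[/eqP p2 /forallP h2].
have len_le (T1 T2 : {set 'I_n}) : \sum_(x in T1) a x = 1 -> prefix p #|T1| = T1 ->
    (forall j : 'I_n, (j < #|T2|)%N ==> (prefix_sum p j < 1)) -> (#|T2| <= #|T1|)%N.
  move=> T11 pT1 hT2; rewrite leqNgt; apply/negP => lt12.
  have T1n : (#|T1| < n)%N.
    exact: leq_trans lt12 (card_set_ord T2).
  have := hT2 (Ordinal T1n); rewrite /= lt12 /= prefix_sum_full // T11.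
  by rewrite ltxx.
have eq12 : #|S1| = #|S2|.
  by apply/eqP; rewrite eqn_leq (len_le S2 S1) // (len_le S1 S2).
by rewrite -p1 -p2 eq12.
Qed.

(** Counting pairs by permutation instead: each [p] is a first hit for at most one [S]. *)
Lemma sum_card_first_hit :
  (\sum_(S : {set 'I_n} | (\sum_(x in S) a x == 1)%R)
     #|[set p | first_hit S p]| <= n`!)%N.
Proof.
under eq_bigr do rewrite -sum1dep_card big_mkcond /=.
rewrite exchange_big /= -card_Sn -sum1_card big_mkcond /=.
apply: leq_sum => p _.
rewrite -big_mkcondr sum1dep_card; apply/card_le1_eqP => S1 S2.
rewrite !inE => /andP[/eqP s1 h1] /andP[/eqP s2 h2].
exact: (first_hit_uniq s2 s1 h2 h1).
Qed.

(** By symmetry the count is the same for all sets of size [w]. These ['C(n, w)] classes partition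
    the [n!] permutations, so each has [n! / 'C(n, w)] elements. *)
Lemma card_prefix_eq S :
  #|[set p | prefix p #|S| == S]| = ((#|S|)`! * (n - #|S|)`!)%N.
Proof.
set w := #|S|.
have wn : (w <= n)%N := card_set_ord S.
have card_pre p : #|prefix p w| = w.
  rewrite card_imset; last exact: perm_inj.
  rewrite -sum1dep_card -(big_ord_widen _ (fun=> 1%N) wn).
  by rewrite sum1_card card_ord.
have eq_card (T : {set 'I_n}) : #|T| = w ->
    #|[set p | prefix p w == T]| = #|[set p | prefix p w == S]|.
  (* Listing [U] before its complement gives a permutation with prefix [U]; two such listings yield
     a relabelling [t] that carries [T] onto [S]. *)
  move=> Tw; pose e (U : {set 'I_n}) := enum U ++ enum (~: U).
  have eU U : uniq (e U).
    rewrite cat_uniq !enum_uniq andbT /=; apply/hasPn => x.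
    by rewrite !mem_enum inE.
  have esz U : size (e U) = n by rewrite size_cat -!cardE cardsC card_ord.
  pose f U (i : 'I_n) := nth i (e U) i.
  have f_inj U : injective (f U).
    move=> i j; rewrite /f (set_nth_default j) ?esz // => /eqP.
    by rewrite nth_uniq ?esz // => /eqP/val_inj.
  have fU (U : {set 'I_n}) : #|U| = w -> prefix (perm (@f_inj U)) w = U.
    move=> Uw; apply/eqP; rewrite eqEcard card_pre Uw leqnn andbT.
    apply/fintype.subsetP => _ /imsetP[i + ->]; rewrite inE permE /f => iw.
    by rewrite nth_cat -cardE Uw iw -mem_enum mem_nth // -cardE Uw.
  pose t := ((perm (@f_inj T))^-1 * perm (@f_inj S))%g.
  have tT : t @: T = S.
    rewrite -(fU T Tw) -[RHS](fU S erefl) -imset_comp; apply: eq_imset => i /=.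
    by rewrite permM permK.
  rewrite -[RHS](card_preimset _ (mulIg t)); apply: eq_card => p; rewrite !inE.
  have -> : prefix (p * t) w = t @: prefix p w.
    by rewrite -imset_comp; apply: eq_imset => i; rewrite /= permM.
  by rewrite -tT (inj_eq (imset_inj perm_inj)).
have eq_fact : ('C(n, w) * #|[set p | prefix p w == S]| = n`!)%N.
  rewrite -{1}(card_ord n) -card_draws -sum_nat_const.
  have <- : (\sum_(p : {perm 'I_n}) 1)%N = n`! by rewrite sum1_card -card_Sn.
  rewrite [RHS](partition_big (fun p => prefix p w) (fun T => #|T| == w)) /=.
    rewrite big_mkcond [RHS]big_mkcond; apply: eq_bigr => T _.
    by rewrite inE; case: eqP => // Tw; rewrite -(eq_card _ Tw) sum1dep_card.
  by move=> p _; rewrite card_pre.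
by apply/eqP; rewrite -(@eqn_pmul2l 'C(n, w)) ?bin_gt0 // bin_fact // eq_fact.
Qed.

(** Multiplication by a fixed rotation is a bijection on permutations, so each of the [w] rotations
    accounts for at most as many [p] as satisfy [Q]. *)
Lemma card_le_rotations w (wn : (w <= n)%N) (P Q : pred {perm 'I_n}) :
  (forall p, P p -> exists r : 'I_w, Q (rotate_prefix r wn * p)%g) ->
  (#|[set p | P p]| <= w * #|[set p | Q p]|)%N.
Proof.
move=> PQ; rewrite -sum1dep_card.
apply: (@leq_trans (\sum_p \sum_(r < w) Q (rotate_prefix r wn * p)%g)%N).
  rewrite big_mkcond /=; apply: leq_sum => p _; case: ifP => // /PQ[r Qr].
  by rewrite (bigD1 r) //= Qr.
rewrite exchange_big /=.
apply: (@leq_trans (\sum_(r < w) #|[set p | Q p]|)%N); last first.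
  by rewrite sum_nat_const card_ord.
apply: leq_sum => r _; rewrite -sum1dep_card.
rewrite [leqRHS](reindex_inj (mulgI (rotate_prefix r wn))) [leqRHS]big_mkcond /=.
by apply: leq_sum => p _; case: ifP.
Qed.

Lemma sum_level_weights :
  (\sum_(S : {set 'I_n} | (\sum_(x in S) a x == 1)%R)
     (#|S|.-1)`! * (n - #|S|)`! <= n`!)%N.
Proof.
apply: leq_trans sum_card_first_hit; apply: leq_sum => S /eqP S1.
have S0 : (0 < #|S|)%N.
  rewrite card_gt0; apply: contra_eq_neq S1 => ->.
  by rewrite big_set0 eq_sym oner_eq0.
have wn := card_set_ord S.
(* Multiplying by [#|S|] turns the weight into [#|S|! (n - #|S|)!], the number of orderings with
   prefix [S]; each has a first hit among its [#|S|] rotations. *)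
rewrite -(leq_pmul2l S0) mulnA -{1}(prednK S0) -factS prednK // -card_prefix_eq.
apply: (@card_le_rotations _ wn) => p /eqP.
exact: some_rotation_first_hit.
Qed.

End Prefixes.

(** * Lower bound by weighted double counting *)

Section LowerBound.
Variables (R : realType) (n : nat).

Definition indicator (S : {set 'I_n}) : 'rV[R]_n := \row_i (i \in S)%:R.

Definition level_weight (S : {set 'I_n}) : nat := (#|S|.-1)`! * (n - #|S|)`!.

Lemma sum_mul_indicator (a : 'I_n -> R) (S : {set 'I_n}) :
  \sum_i a i * indicator S 0 i = \sum_(i in S) a i.
Proof.
rewrite [RHS]big_mkcond; apply: eq_bigr => i _; rewrite mxE.
by case: ifP; rewrite ?mulr1 ?mulr0.
Qed.

Lemma hyperplane_level_weight (H : set 'rV[R]_n) :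
  affine_hyperplane H -> ~ H 0 ->
  (\sum_(S : {set 'I_n} | (0 < #|S|) && (indicator S \in H)) level_weight S <= n`!)%N.
Proof.
move=> [a [b [_ ->]]] /= H0.
have b0 : b != 0.
  apply/eqP => b0; apply: H0; rewrite b0; apply: big1 => i _.
  by rewrite mxE mulr0.
(* Dividing by [b], nonzero because the origin is avoided, normalises the equation to right-hand
   side 1. *)
apply: leq_trans (sum_level_weights (fun i => a 0 i / b)).
rewrite big_mkcond [leqRHS]big_mkcond; apply: leq_sum => S _.
case: ifP => // /andP[_]; rewrite inE /= sum_mul_indicator => Sb.
by rewrite -big_distrl /= Sb divff // eqxx.
Qed.

(** Weighted incidences are counted twice: every nonzero point lies on at least [k] members, and
    every member carries weight at most [n!]. *)
Lemma almost_cover_level_weight k (A : {mset set 'rV[R]_n}%mset) :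
  almost_cover k A ->
  (k * \sum_(S : {set 'I_n} | 0 < #|S|) level_weight S <= size A * n`!)%N.
Proof.
move=> [Ahyp Acov]; rewrite big_distrr /=.
apply: (@leq_trans (\sum_(S : {set 'I_n} | (0 < #|S|)%N)
    count (fun H : set _ => indicator S \in H) A * level_weight S)%N).
  apply: leq_sum => S S0; rewrite leq_mul2r Acov ?orbT //.
    by move=> i; rewrite mxE; case: (i \in S); [right | left].
  move: S0; rewrite card_gt0 => /set0Pn[i iS].
  by apply/eqP => /rowP/(_ i)/eqP; rewrite !mxE iS oner_eq0.
under eq_bigr do rewrite -sum1_count big_mkcond big_distrl /=.
rewrite exchange_big /= mulnC -sum1_size big_distrr /= big_seq [leqRHS]big_seq.
apply: leq_sum => H /Ahyp[Hhyp H0]; rewrite muln1.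
apply: leq_trans (hyperplane_level_weight Hhyp H0).
rewrite [leqRHS]big_mkcondr /=; apply: leq_sum => S _.
by case: ifP; rewrite ?mul1n.
Qed.

End LowerBound.

Lemma sum_over_levels n (F : nat -> nat) :
  (\sum_(S : {set 'I_n}) F #|S| = \sum_(w < n.+1) 'C(n, w) * F w)%N.
Proof.
rewrite (partition_big (fun S : {set 'I_n} => inord #|S| : 'I_n.+1) xpredT) //=.
apply: eq_bigr => w _.
have := card_draws 'I_n w; rewrite card_ord => <-; rewrite -sum_nat_const.
have S_w (S : {set 'I_n}) : (inord #|S| == w) = (#|S| == w).
  by rewrite -val_eqE /= inordK // ltnS card_set_ord.
by apply: eq_big => S; rewrite S_w ?inE // => /eqP ->.
Qed.

Lemma almost_cover6_lower_bound (R : realType) k (A : {mset set 'rV[R]_6}%mset) :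
  almost_cover k A -> (49 * k <= 20 * size A)%N.
Proof.
move=> /almost_cover_level_weight.
have -> : (\sum_(S : {set 'I_6} | 0 < #|S|) level_weight S = 1764)%N.
  rewrite big_mkcond /=.
  (* The conditional excludes the empty set, to which [level_weight] would give 720 since [0.-1] is
     0. *)
  rewrite (sum_over_levels 6 (fun w => if 0 < w then (w.-1)`! * (6 - w)`! else 0)%N).
  by rewrite !big_ord_recl big_ord0.
(* Dividing [1764 * k <= 720 * size A] by 36 leaves the claim. *)
by rewrite (_ : 6`! = 720)%N //; lia.
Qed.

(** * Integer vectors as computable certificates for covers *)

(** Cube points become bit strings and normals integer vectors, so that the covering property is
    decidable by evaluation. *)
Fixpoint dot (v : seq int) (b : seq bool) : int :=
  match v, b with
  | c :: v', e :: b' => (if e then c else 0) + dot v' b'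
  | _, _ => 0
  end.

Fixpoint bitstrings n : seq (seq bool) :=
  if n is m.+1 then [seq e :: b | e <- [:: true; false], b <- bitstrings m]
  else [:: [::]].

(* The vector v stands for the hyperplane of all x with v . x = 1. *)
Definition int_almost_cover (n k : nat) (s : seq (seq int)) : bool :=
  all (fun v => (size v == n) && has (fun c => c != 0) v) s &&
  all (fun b => has id b ==> (k <= count (fun v => dot v b == 1) s)%N)
      (bitstrings n).

Lemma mem_bitstrings b : b \in bitstrings (size b).
Proof.
elim: b => // e b IH; rewrite [bitstrings _]/= cats0 mem_cat.
by case: e; rewrite map_f ?orbT.
Qed.

Lemma int_almost_cover_cat n k l s t :
  int_almost_cover n k s -> int_almost_cover n l t ->
  int_almost_cover n (k + l) (s ++ t).
Proof.
move=> /andP[s1 /allP s2] /andP[t1 /allP t2]; rewrite /int_almost_cover all_cat s1 t1.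
apply/allP => b bn; apply/implyP => b0; rewrite count_cat leq_add //.
  exact: implyP (s2 b bn) b0.
exact: implyP (t2 b bn) b0.
Qed.

Lemma sum_dot (R : pzRingType) v b :
  \sum_(i < size b) (v`_i)%:~R * (nth false b i)%:R = (dot v b)%:~R :> R.
Proof.
elim: b v => [|e b IH] [|c v]; rewrite ?big_ord0 //=.
  by apply: big1 => i _; rewrite nth_nil mul0r.
rewrite big_ord_recl /= IH rmorphD /=; congr (_ + _).
by case: e; rewrite ?mulr1 ?mulr0.
Qed.

(** The hyperplanes of the listed vectors, with repetitions kept as multiplicities, form a real
    almost cover; a cube point is tested through its bit string. *)
Lemma f_le_int_almost_cover (R : realType) (n k : nat) s :
  int_almost_cover n k s -> (f R n k <= size s)%N.
Proof.
move=> /andP[/allP s_vec /allP s_cov].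
pose h (v : seq int) : set 'rV[R]_n :=
  [set x | \sum_(i < n) (v`_i)%:~R * x 0 i = 1]%classic.
have ps : perm_eq (seq_mset (map h s)) (map h s) by exact: perm_eq_seq_mset.
rewrite /f; case: ex_minnP => m _; apply; apply/asboolP.
exists (seq_mset (map h s)); split; last by rewrite (perm_size ps) size_map.
split=> [H|x x01 x0].
  rewrite -[H \in seq_mset _]/(H \in (seq_mset (map h s) : seq _)) (perm_mem ps).
  move=> /mapP[v /s_vec/andP[/eqP vn /hasP[c /(nthP 0)[i]]]].
  rewrite vn => iltn <- vi0 ->; split; last first.
    rewrite /h /= big1 => [/esym/eqP|j _]; first by rewrite oner_eq0.
    by rewrite mxE mulr0.
  exists (\row_j (v`_j)%:~R), 1; split.
    by apply/eqP => /rowP/(_ (Ordinal iltn))/eqP; rewrite !mxE intr_eq0 (negPf vi0).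
  have rowE (y : 'rV[R]_n) : \sum_(j < n) (v`_j)%:~R * y 0 j =
      \sum_j (\row_i (v`_i)%:~R : 'rV[R]_n) 0 j * y 0 j.
    by apply: eq_bigr => j _; rewrite mxE.
  by apply/seteqP; split=> y; rewrite /h /= rowE.
pose b := [seq x 0 i == 1 | i <- enum 'I_n].
have sb : size b = n by rewrite size_map size_enum_ord.
have xb (i : 'I_n) : x 0 i = (nth false b i)%:R.
  rewrite (nth_map i) ?size_enum_ord // nth_ord_enum.
  by case: (x01 i) => ->; rewrite ?eqxx // eq_sym oner_eq0.
have b0 : has id b.
  apply: contraNT x0 => /hasPn nb; apply/eqP/rowP => i; rewrite mxE xb.
  by have /negPf -> : ~~ nth false b i by apply: nb; rewrite mem_nth ?sb.
have := mem_bitstrings b; rewrite sb => /s_cov; rewrite b0 => /leq_trans; apply.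
rewrite (seq.permP ps) count_map; apply: sub_count => v /= /eqP vb.
rewrite inE /h /=; under eq_bigr do rewrite xb.
by have := sum_dot R v b; rewrite sb vb.
Qed.

(** * Explicit covers *)

(* Only one hyperplane from each orbit is listed, together with its
   multiplicity, the group being the cyclic shifts of all coordinates but the
   first. *)
Definition orbit_cover (s : seq (nat * seq int)) : seq (seq int) :=
  flatten [seq flatten (nseq p.1 (undup
    [seq head 0 p.2 :: rot i (behead p.2) | i <- iota 0 (size p.2).-1])) | p <- s].

(** A tight cover with exactly [49 * 20 / 20] members, hence addable at no loss. Tails with all
    entries equal contribute one vector per multiplicity, other tails five. *)
Definition cover20 := orbit_cover ([::
  (1%N, [:: 1; 1; 1; 0; -2; 0]); (1%N, [:: 1; 1; 0; 1; -1; -1]);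
  (1%N, [:: 1; 1; 0; 0; 1; -1]); (1%N, [:: 1; 1; 0; 0; 0; 0]);
  (2%N, [:: 0; 1; 1; 1; 1; 1]); (1%N, [:: 0; 1; 1; 1; 0; 0]);
  (1%N, [:: 0; 1; 1; 0; 0; 0]); (1%N, [:: 0; 1; 0; 1; 0; 0]);
  (2%N, [:: 0; 1; 0; 0; 0; 0]); (2%N, [:: -3; 1; 1; 1; 1; 1])])%Z.

(** It has 59 members, and [20 * 59 = 49 * 24 + 4], so three copies still respect the allowed excess
    of 19. *)
Definition cover24 := orbit_cover ([::
  (1%N, [:: 1; 1; 1; 1; 1; 1]); (1%N, [:: 1; 1; 1; -1; 0; 0]);
  (1%N, [:: 1; 1; 0; 1; 0; 0]); (1%N, [:: 1; 1; 0; 1; 0; -1]);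
  (1%N, [:: 1; 1; 0; 0; 0; 0]); (3%N, [:: 1; 0; 0; 0; 0; 0]);
  (1%N, [:: 0; 1; 1; 1; 1; 1]); (1%N, [:: 0; 1; 1; 0; 0; 0]);
  (1%N, [:: 0; 1; 1; -1; 0; 0]); (1%N, [:: 0; 1; 0; 1; 0; 0]);
  (1%N, [:: 0; 1; 0; 1; 0; -1]); (1%N, [:: 0; 1; 0; 0; 0; 0]);
  (1%N, [:: -1; 1; 1; 1; 1; 1]); (1%N, [:: -1; 1; 1; 0; 0; 0]);
  (1%N, [:: -2; 1; 1; 1; 1; 1]); (1%N, [:: -3; 1; 1; 1; 1; 1]);
  (1%N, [:: -4; 1; 1; 1; 1; 1])])%Z.

Definition cover65 := orbit_cover ([::
  (1%N, [:: 1; 1; 1; 0; 1; 0]); (1%N, [:: 1; 1; 1; -1; 0; 0]);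
  (1%N, [:: 1; 1; 1; -2; 1; -1]); (1%N, [:: 1; 1; 0; 1; 0; -2]);
  (1%N, [:: 1; 1; 0; 1; -1; -1]); (2%N, [:: 1; 1; 0; 0; 1; -2]);
  (5%N, [:: 1; 1; 0; 0; 0; 0]); (1%N, [:: 1; 1; -1; 0; 0; 0]);
  (1%N, [:: 1; 0; 0; 0; 0; 0]); (1%N, [:: 0; 1; 1; 1; -1; 0]);
  (5%N, [:: 0; 1; 1; 0; 0; 0]); (1%N, [:: 0; 1; 1; 0; -1; 0]);
  (3%N, [:: 0; 1; 0; 1; 0; 0]); (1%N, [:: 0; 1; 0; 1; 0; -1]);
  (2%N, [:: 0; 1; 0; 0; 1; -1]); (3%N, [:: 0; 1; 0; 0; 0; 0]);
  (1%N, [:: -1; 1; 1; 1; 1; 1]); (4%N, [:: -2; 1; 1; 1; 1; 1]);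
  (1%N, [:: -2; 1; 1; 1; 1; 0]); (4%N, [:: -3; 1; 1; 1; 1; 1])])%Z.

Definition cover66 := orbit_cover ([::
  (2%N, [:: 1; 1; 1; 1; 1; 1]); (1%N, [:: 1; 1; 1; 1; -2; -1]);
  (1%N, [:: 1; 1; 1; 0; 1; -1]); (1%N, [:: 1; 1; 1; -1; 0; 0]);
  (1%N, [:: 1; 1; 1; -2; 1; 0]); (6%N, [:: 1; 1; 0; 0; 0; 0]);
  (1%N, [:: 1; 1; 0; -1; 0; 0]); (1%N, [:: 1; 1; -1; 0; 0; 0]);
  (4%N, [:: 1; 0; 0; 0; 0; 0]); (1%N, [:: 0; 1; 1; 1; 1; 1]);
  (1%N, [:: 0; 1; 1; 0; 1; -1]); (1%N, [:: 0; 1; 1; 0; 1; -2]);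
  (4%N, [:: 0; 1; 1; 0; 0; 0]); (1%N, [:: 0; 1; 1; 0; 0; -1]);
  (3%N, [:: 0; 1; 0; 1; 0; 0]); (1%N, [:: 0; 1; 0; 1; -1; 0]);
  (3%N, [:: 0; 1; 0; 0; 0; 0]); (1%N, [:: -1; 1; 1; 0; 1; 0]);
  (1%N, [:: -2; 1; 1; 1; 1; 1]); (2%N, [:: -2; 1; 1; 1; 0; 0]);
  (1%N, [:: -2; 1; 1; 0; 1; 0]); (2%N, [:: -3; 1; 1; 1; 1; 1]);
  (2%N, [:: -4; 1; 1; 1; 1; 1])])%Z.

Definition cover67 := orbit_cover ([::
  (1%N, [:: 1; 1; 1; 1; 0; -2]); (1%N, [:: 1; 1; 1; 1; -2; -1]);
  (1%N, [:: 1; 1; 1; -1; 1; -2]); (1%N, [:: 1; 1; 1; -2; 0; 0]);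
  (7%N, [:: 1; 1; 0; 0; 0; 0]); (1%N, [:: 1; 1; 0; 0; -1; 0]);
  (1%N, [:: 1; 1; 0; -1; 0; 0]); (2%N, [:: 1; 0; 0; 0; 0; 0]);
  (1%N, [:: 0; 1; 1; 1; 1; 1]); (4%N, [:: 0; 1; 1; 0; 0; 0]);
  (1%N, [:: 0; 1; 1; -1; 1; 0]); (1%N, [:: 0; 1; 1; -2; 1; 0]);
  (3%N, [:: 0; 1; 0; 1; 0; 0]); (2%N, [:: 0; 1; 0; 1; -1; 0]);
  (1%N, [:: 0; 1; 0; 0; 1; -1]); (2%N, [:: 0; 1; 0; 0; 0; 0]);
  (1%N, [:: -1; 1; 1; 1; 1; 1]); (1%N, [:: -1; 1; 1; 0; 1; 0]);
  (1%N, [:: -1; 1; 1; 0; 0; 0]); (2%N, [:: -2; 1; 1; 1; 1; 0]);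
  (1%N, [:: -2; 1; 1; 1; 0; 0]); (1%N, [:: -4; 1; 1; 1; 1; 1])])%Z.

Definition cover69 := orbit_cover ([::
  (1%N, [:: 1; 1; 1; 1; 1; 1]); (1%N, [:: 1; 1; 1; 1; 1; -1]);
  (1%N, [:: 1; 1; 1; 1; 0; 0]); (1%N, [:: 1; 1; 1; 1; 0; -2]);
  (1%N, [:: 1; 1; 1; 0; 1; -3]); (1%N, [:: 1; 1; 0; 1; -1; 0]);
  (1%N, [:: 1; 1; 0; 0; 1; -1]); (1%N, [:: 1; 1; 0; 0; 1; -2]);
  (4%N, [:: 1; 1; 0; 0; 0; 0]); (1%N, [:: 1; 1; 0; 0; 0; -1]);
  (1%N, [:: 1; 1; 0; 0; -1; 0]); (4%N, [:: 1; 0; 0; 0; 0; 0]);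
  (1%N, [:: 0; 1; 1; 1; 1; -3]); (1%N, [:: 0; 1; 1; 1; 0; -1]);
  (1%N, [:: 0; 1; 1; 1; -2; 0]); (5%N, [:: 0; 1; 1; 0; 0; 0]);
  (4%N, [:: 0; 1; 0; 1; 0; 0]); (1%N, [:: 0; 1; 0; 1; 0; -1]);
  (4%N, [:: 0; 1; 0; 0; 0; 0]); (1%N, [:: -1; 1; 1; 1; -1; 0]);
  (1%N, [:: -1; 1; 1; 0; 1; 0]); (1%N, [:: -1; 1; 1; 0; 1; -1])])%Z.

Definition cover70 := orbit_cover ([::
  (1%N, [:: 1; 1; 1; 1; 0; -2]); (1%N, [:: 1; 1; 1; 1; -1; 0]);
  (2%N, [:: 1; 1; 1; -1; 1; -2]); (1%N, [:: 1; 1; 1; -1; 0; 0]);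
  (1%N, [:: 1; 1; 1; -2; 1; 0]); (1%N, [:: 1; 1; 0; 1; -2; 0]);
  (4%N, [:: 1; 1; 0; 0; 0; 0]); (2%N, [:: 1; 1; 0; -1; 0; 0]);
  (1%N, [:: 1; 1; -1; 0; 0; 0]); (1%N, [:: 0; 1; 1; 1; 1; 1]);
  (5%N, [:: 0; 1; 1; 0; 0; 0]); (1%N, [:: 0; 1; 1; 0; 0; -1]);
  (2%N, [:: 0; 1; 1; 0; -1; 0]); (2%N, [:: 0; 1; 1; -1; 1; 0]);
  (4%N, [:: 0; 1; 0; 1; 0; 0]); (1%N, [:: 0; 1; 0; 1; -1; 0]);
  (2%N, [:: 0; 1; 0; 0; 1; -1]); (1%N, [:: 0; 1; 0; 0; 0; 0]);
  (1%N, [:: -1; 1; 1; 0; 1; 0]); (1%N, [:: -1; 1; 1; 0; 0; 0]);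
  (1%N, [:: -3; 1; 1; 1; 1; 1])])%Z.

Definition cover73 := orbit_cover ([::
  (1%N, [:: 1; 1; 1; 1; 1; -3]); (1%N, [:: 1; 1; 1; 1; -2; -1]);
  (1%N, [:: 1; 1; 1; 0; -2; 0]); (1%N, [:: 1; 1; 1; -1; 0; 0]);
  (1%N, [:: 1; 1; 0; 1; -1; 0]); (2%N, [:: 1; 1; 0; 0; 1; -2]);
  (6%N, [:: 1; 1; 0; 0; 0; 0]); (1%N, [:: 1; 1; 0; -1; 0; 0]);
  (3%N, [:: 1; 0; 0; 0; 0; 0]); (1%N, [:: 0; 1; 1; 1; 1; 0]);
  (1%N, [:: 0; 1; 1; 1; -1; 0]); (4%N, [:: 0; 1; 1; 0; 0; 0]);
  (1%N, [:: 0; 1; 1; 0; 0; -1]); (5%N, [:: 0; 1; 0; 1; 0; 0]);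
  (1%N, [:: 0; 1; 0; 1; 0; -1]); (4%N, [:: 0; 1; 0; 0; 0; 0]);
  (1%N, [:: -1; 1; 1; 1; 1; 1]); (1%N, [:: -1; 1; 1; 0; 0; 0]);
  (4%N, [:: -2; 1; 1; 1; 1; 1]); (1%N, [:: -3; 1; 1; 1; 1; 1]);
  (2%N, [:: -3; 1; 1; 1; 1; 0])])%Z.

Definition cover74 := orbit_cover ([::
  (2%N, [:: 1; 1; 1; 1; 1; 1]); (1%N, [:: 1; 1; 1; 1; -1; -2]);
  (1%N, [:: 1; 1; 1; 0; 1; 0]); (1%N, [:: 1; 1; 1; 0; 0; 0]);
  (1%N, [:: 1; 1; 1; 0; -1; 0]); (1%N, [:: 1; 1; 1; -1; 0; 0]);
  (1%N, [:: 1; 1; 1; -1; 0; -1]); (1%N, [:: 1; 1; 0; 0; 1; -1]);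
  (4%N, [:: 1; 1; 0; 0; 0; 0]); (1%N, [:: 1; 1; 0; 0; 0; -1]);
  (2%N, [:: 1; 1; 0; 0; -1; 0]); (2%N, [:: 1; 0; 0; 0; 0; 0]);
  (1%N, [:: 0; 1; 1; 1; 1; 1]); (1%N, [:: 0; 1; 1; 1; 0; -1]);
  (1%N, [:: 0; 1; 1; 0; 1; -1]); (2%N, [:: 0; 1; 1; 0; 0; 0]);
  (2%N, [:: 0; 1; 1; 0; 0; -1]); (3%N, [:: 0; 1; 1; 0; -1; 0]);
  (6%N, [:: 0; 1; 0; 1; 0; 0]); (3%N, [:: 0; 1; 0; 0; 0; 0]);
  (1%N, [:: -1; 1; 1; 0; 1; 0]); (1%N, [:: -2; 1; 1; 1; 1; 1]);
  (1%N, [:: -2; 1; 1; 1; 0; 0]); (3%N, [:: -3; 1; 1; 1; 1; 1]);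
  (3%N, [:: -4; 1; 1; 1; 1; 1])])%Z.

Definition cover75 := orbit_cover ([::
  (1%N, [:: 1; 1; 1; 1; 1; 1]); (1%N, [:: 1; 1; 1; 1; 1; 0]);
  (1%N, [:: 1; 1; 1; 1; 1; -3]); (1%N, [:: 1; 1; 1; 1; 0; -2]);
  (1%N, [:: 1; 1; 1; 1; -2; -1]); (1%N, [:: 1; 1; 1; 0; 1; 0]);
  (1%N, [:: 1; 1; 1; 0; 0; 0]); (1%N, [:: 1; 1; 0; 1; 0; 0]);
  (1%N, [:: 1; 1; 0; 0; 1; -1]); (3%N, [:: 1; 1; 0; 0; 0; 0]);
  (1%N, [:: 1; 1; 0; 0; -1; 0]); (2%N, [:: 1; 1; -1; 0; 0; 0]);
  (4%N, [:: 1; 0; 0; 0; 0; 0]); (1%N, [:: 0; 1; 1; 1; -2; 0]);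
  (1%N, [:: 0; 1; 1; 0; 1; 0]); (5%N, [:: 0; 1; 1; 0; 0; 0]);
  (1%N, [:: 0; 1; 1; -1; 1; 0]); (1%N, [:: 0; 1; 1; -1; 0; 0]);
  (1%N, [:: 0; 1; 1; -2; 1; 0]); (4%N, [:: 0; 1; 0; 1; 0; 0]);
  (6%N, [:: 0; 1; 0; 0; 0; 0]); (1%N, [:: -1; 1; 1; -1; 1; 0]);
  (2%N, [:: -2; 1; 1; 1; 1; 1]); (1%N, [:: -3; 1; 1; 1; 1; 1]);
  (1%N, [:: -4; 1; 1; 1; 1; 1])])%Z.

Definition cover76 := orbit_cover ([::
  (1%N, [:: 1; 1; 1; 1; 1; -1]); (1%N, [:: 1; 1; 1; 1; -1; 0]);
  (1%N, [:: 1; 1; 1; 0; 0; 0]); (2%N, [:: 1; 1; 1; -1; 0; 0]);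
  (1%N, [:: 1; 1; 1; -2; 0; 0]); (1%N, [:: 1; 1; 0; 1; 0; -1]);
  (1%N, [:: 1; 1; 0; 1; -1; 0]); (3%N, [:: 1; 1; 0; 0; 0; 0]);
  (3%N, [:: 1; 1; 0; -1; 0; 0]); (1%N, [:: 1; 1; -1; 0; 0; 0]);
  (1%N, [:: 1; 0; 0; 0; 0; 0]); (1%N, [:: 0; 1; 1; 1; 0; -1]);
  (1%N, [:: 0; 1; 1; 1; -2; 0]); (1%N, [:: 0; 1; 1; 0; 1; 0]);
  (3%N, [:: 0; 1; 1; 0; 0; 0]); (1%N, [:: 0; 1; 1; 0; -1; 0]);
  (1%N, [:: 0; 1; 1; -1; 1; 0]); (1%N, [:: 0; 1; 1; -1; 0; 0]);
  (4%N, [:: 0; 1; 0; 1; 0; 0]); (1%N, [:: 0; 1; 0; 0; 1; -1]);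
  (5%N, [:: 0; 1; 0; 0; 0; 0]); (1%N, [:: -1; 1; 1; 1; 1; 0]);
  (3%N, [:: -2; 1; 1; 1; 1; 1]); (1%N, [:: -2; 1; 1; 0; 1; 0]);
  (2%N, [:: -3; 1; 1; 1; 1; 1]); (1%N, [:: -4; 1; 1; 1; 1; 1])])%Z.

Definition cover77 := orbit_cover ([::
  (1%N, [:: 1; 1; 1; 1; 1; 1]); (1%N, [:: 1; 1; 1; 1; 0; 0]);
  (1%N, [:: 1; 1; 1; 1; -1; -1]); (2%N, [:: 1; 1; 1; 0; 1; -1]);
  (1%N, [:: 1; 1; 1; 0; -1; 0]); (1%N, [:: 1; 1; 1; -3; 1; 0]);
  (1%N, [:: 1; 1; 0; 0; 1; -1]); (4%N, [:: 1; 1; 0; 0; 0; 0]);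
  (1%N, [:: 1; 1; 0; 0; 0; -1]); (2%N, [:: 1; 1; 0; -1; 0; 0]);
  (1%N, [:: 1; 1; -1; 0; 0; 0]); (1%N, [:: 1; 0; 0; 0; 0; 0]);
  (3%N, [:: 0; 1; 1; 1; 1; 1]); (1%N, [:: 0; 1; 1; 1; 1; 0]);
  (2%N, [:: 0; 1; 1; 1; 0; 0]); (1%N, [:: 0; 1; 1; 0; 1; 0]);
  (3%N, [:: 0; 1; 1; 0; 0; 0]); (1%N, [:: 0; 1; 1; -1; 1; 0]);
  (2%N, [:: 0; 1; 0; 1; 0; 0]); (1%N, [:: 0; 1; 0; 1; -1; 0]);
  (8%N, [:: 0; 1; 0; 0; 0; 0]); (1%N, [:: -1; 1; 1; 0; 1; 0]);
  (3%N, [:: -2; 1; 1; 1; 1; 1]); (1%N, [:: -2; 1; 1; 1; 0; 0]);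
  (1%N, [:: -4; 1; 1; 1; 1; 1])])%Z.

Definition cover78 := orbit_cover ([::
  (1%N, [:: 1; 1; 1; 1; 0; 0]); (1%N, [:: 1; 1; 1; 1; -1; -2]);
  (1%N, [:: 1; 1; 1; 1; -3; 0]); (2%N, [:: 1; 1; 1; 0; 0; 0]);
  (1%N, [:: 1; 1; 1; 0; 0; -1]); (1%N, [:: 1; 1; 1; 0; -1; 0]);
  (1%N, [:: 1; 1; 1; -1; 0; 0]); (1%N, [:: 1; 1; 0; 1; 0; -1]);
  (1%N, [:: 1; 1; 0; 1; -1; 0]); (2%N, [:: 1; 1; 0; 0; 0; 0]);
  (1%N, [:: 1; 1; 0; 0; 0; -1]); (2%N, [:: 1; 1; 0; -1; 0; 0]);
  (3%N, [:: 1; 0; 0; 0; 0; 0]); (1%N, [:: 0; 1; 1; 1; 1; 0]);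
  (1%N, [:: 0; 1; 1; 1; 0; 0]); (1%N, [:: 0; 1; 1; 0; 1; 0]);
  (1%N, [:: 0; 1; 1; 0; 1; -1]); (2%N, [:: 0; 1; 1; 0; 0; 0]);
  (1%N, [:: 0; 1; 1; 0; 0; -1]); (1%N, [:: 0; 1; 1; 0; -1; 0]);
  (1%N, [:: 0; 1; 1; -1; 1; 0]); (4%N, [:: 0; 1; 0; 1; 0; 0]);
  (7%N, [:: 0; 1; 0; 0; 0; 0]); (4%N, [:: -1; 1; 1; 1; 1; 1]);
  (1%N, [:: -1; 1; 0; 1; 0; 0]); (4%N, [:: -2; 1; 1; 1; 1; 1]);
  (1%N, [:: -3; 1; 1; 1; 1; 1])])%Z.

Definition cover79 := orbit_cover ([::
  (1%N, [:: 1; 1; 1; 1; 1; 0]); (1%N, [:: 1; 1; 1; 1; 1; -3]);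
  (1%N, [:: 1; 1; 1; 0; 1; -2]); (2%N, [:: 1; 1; 1; 0; 0; 0]);
  (1%N, [:: 1; 1; 1; -1; -1; 0]); (6%N, [:: 1; 1; 0; 0; 0; 0]);
  (2%N, [:: 1; 1; 0; 0; 0; -1]); (1%N, [:: 1; 1; 0; -1; 0; 0]);
  (4%N, [:: 1; 0; 0; 0; 0; 0]); (2%N, [:: 0; 1; 1; 1; -2; 0]);
  (5%N, [:: 0; 1; 1; 0; 0; 0]); (4%N, [:: 0; 1; 0; 1; 0; 0]);
  (1%N, [:: 0; 1; 0; 1; 0; -1]); (1%N, [:: 0; 1; 0; 1; -1; 0]);
  (1%N, [:: 0; 1; 0; 0; 1; -1]); (3%N, [:: 0; 1; 0; 0; 0; 0]);
  (1%N, [:: -1; 1; 1; 1; 0; 0]); (1%N, [:: -1; 1; 1; 0; 1; -1]);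
  (2%N, [:: -1; 1; 0; 1; 0; 0]); (5%N, [:: -2; 1; 1; 1; 1; 1]);
  (4%N, [:: -3; 1; 1; 1; 1; 1]); (1%N, [:: -4; 1; 1; 1; 1; 1])])%Z.

Definition cover81 := orbit_cover ([::
  (1%N, [:: 1; 1; 1; 1; -2; 0]); (1%N, [:: 1; 1; 1; 1; -2; -1]);
  (1%N, [:: 1; 1; 1; 0; -1; 0]); (2%N, [:: 1; 1; 1; 0; -2; 0]);
  (1%N, [:: 1; 1; 0; 1; 0; -1]); (1%N, [:: 1; 1; 0; 1; -1; 0]);
  (2%N, [:: 1; 1; 0; 0; 1; -1]); (4%N, [:: 1; 1; 0; 0; 0; 0]);
  (1%N, [:: 1; 1; 0; 0; 0; -1]); (1%N, [:: 1; 1; 0; -1; 0; 0]);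
  (1%N, [:: 1; 1; -1; 0; 0; 0]); (1%N, [:: 1; 0; 0; 0; 0; 0]);
  (2%N, [:: 0; 1; 1; 1; 1; 1]); (3%N, [:: 0; 1; 1; 1; 0; 0]);
  (1%N, [:: 0; 1; 1; 1; 0; -1]); (1%N, [:: 0; 1; 1; 1; -1; 0]);
  (2%N, [:: 0; 1; 1; 0; 0; 0]); (2%N, [:: 0; 1; 1; 0; -1; 0]);
  (5%N, [:: 0; 1; 0; 1; 0; 0]); (5%N, [:: 0; 1; 0; 0; 0; 0]);
  (1%N, [:: -1; 1; 1; 1; 1; 1]); (1%N, [:: -1; 1; 1; 1; 1; -2]);
  (1%N, [:: -1; 1; 1; 1; 0; 0]); (1%N, [:: -1; 1; 0; 1; 0; 0]);
  (1%N, [:: -2; 1; 1; 1; 1; -1])])%Z.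

Definition cover83 := orbit_cover ([::
  (1%N, [:: 1; 1; 1; 1; 1; -2]); (1%N, [:: 1; 1; 1; 1; 0; -3]);
  (1%N, [:: 1; 1; 1; 0; 1; -2]); (1%N, [:: 1; 1; 1; 0; 0; 0]);
  (1%N, [:: 1; 1; 1; -1; 1; 0]); (1%N, [:: 1; 1; 1; -1; 1; -1]);
  (1%N, [:: 1; 1; 1; -2; 0; 0]); (2%N, [:: 1; 1; 0; 1; 0; -1]);
  (1%N, [:: 1; 1; 0; 0; 1; -1]); (3%N, [:: 1; 1; 0; 0; 0; 0]);
  (1%N, [:: 1; 1; 0; 0; -1; 0]); (2%N, [:: 1; 1; 0; -1; 0; 0]);
  (3%N, [:: 1; 0; 0; 0; 0; 0]); (1%N, [:: 0; 1; 1; 1; 1; 0]);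
  (1%N, [:: 0; 1; 1; 1; 1; -3]); (1%N, [:: 0; 1; 1; 1; 0; 0]);
  (1%N, [:: 0; 1; 1; 1; 0; -1]); (1%N, [:: 0; 1; 1; 0; 1; 0]);
  (4%N, [:: 0; 1; 1; 0; 0; 0]); (1%N, [:: 0; 1; 1; 0; -1; 0]);
  (1%N, [:: 0; 1; 1; -1; 0; 0]); (5%N, [:: 0; 1; 0; 1; 0; 0]);
  (6%N, [:: 0; 1; 0; 0; 0; 0]); (1%N, [:: -1; 1; 1; 1; 0; -1]);
  (1%N, [:: -1; 1; 1; 0; 0; 0]); (1%N, [:: -3; 1; 1; 1; 1; 1])])%Z.


(** Only 71 and 82 are absent between 65 and 84, the two excluded residues. The values 68, 72, 80
    and 84 are sums of 20s and 24s and reuse those covers. *)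
Definition small_covers : seq (nat * seq (seq int)) :=
  [:: (65, cover65); (66, cover66); (67, cover67);
      (68, cover20 ++ cover24 ++ cover24); (69, cover69); (70, cover70);
      (72, cover24 ++ cover24 ++ cover24); (73, cover73); (74, cover74);
      (75, cover75); (76, cover76); (77, cover77); (78, cover78);
      (79, cover79); (80, cover20 ++ cover20 ++ cover20 ++ cover20);
      (81, cover81); (83, cover83);
      (84, cover20 ++ cover20 ++ cover20 ++ cover24)]%N.

(** * Verification of the covers and extension to all [k] *)

(** The numerical condition is the integer form of [size < 49 k / 20 + 1]. *)
Lemma small_coversP :
  all (fun p => int_almost_cover 6 p.1 p.2 &&
                (20 * size p.2 <= 49 * p.1 + 19)%N) small_covers.
Proof. by vm_compute. Qed.

Lemma cover20P : int_almost_cover 6 20 cover20 && (size cover20 == 49%N).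
Proof. by vm_compute. Qed.

Lemma small_covers_residues (r : nat) :
  (65 <= r < 85)%N -> (r %% 20 != 2)%N -> (r %% 20 != 11)%N ->
  r \in unzip1 small_covers.
Proof.
move=> r_range; have : r \in iota 65 20 by rewrite mem_iota.
have /allP : all (fun r => (r %% 20 != 2) ==> (r %% 20 != 11) ==>
  (r \in unzip1 small_covers))%N (iota 65 20) by [].
by move=> all_r /all_r/implyP r_ok /r_ok/implyP.
Qed.

(** Start from the cover for the representative [r] of [k] modulo 20 in [65 <= r < 85] and append
    copies of [cover20]; each adds [20 * 49] to both sides of the size bound. *)
Lemma ex_int_almost_cover6 k :
  (65 <= k)%N -> (k %% 20 != 2)%N -> (k %% 20 != 11)%N ->
  exists2 s, int_almost_cover 6 k s & (20 * size s <= 49 * k + 19)%N.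
Proof.
move=> k65 k2 k11; pose r := (65 + (k - 65) %% 20)%N.
have kE : (k = r + (k - 65) %/ 20 * 20)%N.
  by rewrite /r -addnA [(_ %% _ + _)%N]addnC -divn_eq subnKC.
have rE : (k %% 20 = r %% 20)%N by rewrite {1}kE addnC modnMDl.
move: k2 k11; rewrite rE kE; have rlt : (65 <= r < 85)%N.
  by rewrite /r leq_addr (ltn_add2l 65 _ 20) ltn_mod.
elim: (_ %/ 20)%N => [|q IH] r2 r11; last first.
  have [s s_cov s_size] := IH r2 r11.
  have /andP[cov20 /eqP size20] := cover20P.
  exists (s ++ cover20); last by rewrite size_cat size20; lia.
  by rewrite mulSn addnCA [(20 + _)%N]addnC; apply: int_almost_cover_cat.
rewrite mul0n addn0.
have /mapP[[r' s] in_small /= ->] := small_covers_residues rlt r2 r11.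
by have /allP/(_ _ in_small)/andP[] := small_coversP; exists s.
Qed.

Theorem theorem1p5 (R : realType) (k : nat) :
  (65 <= k)%N -> k <> 2 %[mod 20] -> k <> 11 %[mod 20] ->
  (f R 6 k)%:Z = Num.ceil (49 * k%:R / 20 : R).
Proof.
(* The ceiling is characterised by [f - 1 < 49 k / 20 <= f]; clearing the denominator gives two
   inequalities between naturals. *)
move=> k65 /eqP k2 /eqP k11; apply/esym/ceil_def.
have lower : (49 * k <= 20 * f R 6 k)%N.
  rewrite /f; case: ex_minnP => m /asboolP[A [A_cov <-]] _.
  exact: almost_cover6_lower_bound A_cov.
have upper : (20 * f R 6 k < 49 * k + 20)%N.
  have [s s_cov s_size] := ex_int_almost_cover6 k65 k2 k11.
  by have := f_le_int_almost_cover R s_cov; lia.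
have lowerR : 49 * k%:R <= 20 * (f R 6 k)%:R :> R by rewrite -!natrM ler_nat.
have upperR : 20 * (f R 6 k)%:R < 49 * k%:R + 20 :> R.
  by rewrite -!natrM -natrD ltr_nat.
by rewrite rmorphB /= -pmulrn; apply/andP; split; lra.
Qed.
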